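(* In three spacetime dimensions, let $\mathcal{Y}_{(6)}=6\mathcal{S}_3^2-\mathcal{S}_2^3$. For every $n\ge6$, the most general order-$n$ density satisfying a simple holographic c-theorem is $$\mathcal{L}_{(n)}=\alpha_n\,\mathcal{C}_{(n)}+\mathcal{Y}_{(6)}\cdot\mathcal{L}^{\rm general}_{(n-6)},$$ where $\alpha_n$ is a constant and $\mathcal{L}^{\rm general}_{(n-6)}$ is an arbitrary density of order $n-6$; for $1\le n\le5$ it is $\alpha_n\mathcal{C}_{(n)}$. In particular, all densities which satisfy the holographic c-theorem trivially (i.e. vanish identically when evaluated on the c-theorem ansatz) are proportional to $\mathcal{Y}_{(6)}$, and at order $n\ge6$ there are $\#(n-6)=\#(n)-n$ linearly independent ones.
   Context: $R_{\langle ab\rangle}=R_{ab}-\frac13g_{ab}R$, $\mathcal{S}_2=R_{\langle a}{}^{b\rangle}R_{\langle b}{}^{a\rangle}$, $\mathcal{S}_3=R_{\langle a}{}^{b\rangle}R_{\langle b}{}^{c\rangle}R_{\langle c}{}^{a\rangle}$. An order-$n$ density is a linear combination of the (independent) monomials $R^i\mathcal{S}_2^j\mathcal{S}_3^k$ with $i+2j+3k=n$; $\#(n)$ is the number of these monomials. c-theorem ansatz: $ds^2=dr^2+a(r)^2(-dt^2+dx^2)$. A density satisfies a simple holographic c-theorem if its evaluation on this ansatz contains no derivatives of $a$ higher than the second and no powers of $a''$ higher than one (so that the resulting equations for $a$ are second order). On the ansatz, $R|_a=-\frac{2(a'^2+2aa'')}{a^2}$, $\mathcal{S}_2|_a=\frac{2(a'^2-aa'')^2}{3a^4}$,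 $\mathcal{S}_3|_a=\frac{2(a'^2-aa'')^3}{9a^6}$. $\mathcal{C}_{(n)}$ is the order-$n$ polynomial density $$\mathcal{C}_{(n)}=\frac{3(-1)^n}{4\cdot6^n n}\Big\{(R+\sqrt{24\mathcal{S}_2})^{n-1}\big(R-(n-1)\sqrt{24\mathcal{S}_2}\big)\big(1-\tfrac{\sqrt6\,\mathcal{S}_3}{\mathcal{S}_2^{3/2}}\big)+(R-\sqrt{24\mathcal{S}_2})^{n-1}\big(R+(n-1)\sqrt{24\mathcal{S}_2}\big)\big(1+\tfrac{\sqrt6\,\mathcal{S}_3}{\mathcal{S}_2^{3/2}}\big)\Big\},$$ which satisfies $\mathcal{C}_{(n)}|_a=\big(\tfrac{a'}{a}\big)^{2(n-1)}\big[\tfrac{a''}{a}+\tfrac{3-2n}{2n}\big(\tfrac{a'}{a}\big)^2\big]$. *)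

(* Defs.v *)
(* [mpoly] has to be imported before MathComp-Analysis: in the opposite order
   their notations clash. *)
From HB Require Import structures.
From mathcomp Require Import all_boot all_order all_algebra.
From mathcomp Require Import mpoly.
From mathcomp Require Import boolp classical_sets reals topology normedtype derive exp.
Set Implicit Arguments. Unset Strict Implicit. Unset Printing Implicit Defensive.
Import Order.TTheory GRing.Theory Num.Theory numFieldNormedType.Exports.
Local Open Scope ring_scope.

(* Curvature of a metric on a coordinate patch of dimension 3.  A metric is
   given by its matrix of components [g_ij] as a function of the point. *)

Definition partial (K : realType) (k : 'I_3) (f : 'rV[K]_3 -> K)
  (p : 'rV[K]_3) : K := 'D_(delta_mx 0 k) f p.

Definition christoffel (K : realType) (g : 'rV[K]_3 -> 'M[K]_3)
    (i j k : 'I_3) (p : 'rV[K]_3) : K :=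
  2^-1 * \sum_(l < 3) invmx (g p) i l *
    (partial j (fun q => g q l k) p + partial k (fun q => g q j l) p
     - partial l (fun q => g q j k) p).

(* Sign convention: round spheres have positive Ricci curvature. *)
Definition ricci (K : realType) (g : 'rV[K]_3 -> 'M[K]_3) (p : 'rV[K]_3) :
    'M[K]_3 :=
  \matrix_(j, k)
    (\sum_(i < 3) partial i (christoffel g i j k) p
     - \sum_(i < 3) partial k (christoffel g i j i) p
     + \sum_(i < 3) \sum_(l < 3)
         (christoffel g i i l p * christoffel g l j k p
          - christoffel g i k l p * christoffel g l j i p)).

Definition scalar_curv (K : realType) (g : 'rV[K]_3 -> 'M[K]_3)
    (p : 'rV[K]_3) : K :=
  \tr (ricci g p *m invmx (g p)).

(* The traceless Ricci tensor R_<ab>, and its mixed form R_<a>^<b>. *)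
Definition tl_ricci (K : realType) (g : 'rV[K]_3 -> 'M[K]_3)
    (p : 'rV[K]_3) : 'M[K]_3 :=
  ricci g p - (3^-1 * scalar_curv g p) *: g p.

Definition tl_ricci_mixed (K : realType) (g : 'rV[K]_3 -> 'M[K]_3)
    (p : 'rV[K]_3) : 'M[K]_3 :=
  tl_ricci g p *m invmx (g p).

Definition S2_curv (K : realType) (g : 'rV[K]_3 -> 'M[K]_3)
    (p : 'rV[K]_3) : K :=
  \tr (tl_ricci_mixed g p *m tl_ricci_mixed g p).

Definition S3_curv (K : realType) (g : 'rV[K]_3 -> 'M[K]_3)
    (p : 'rV[K]_3) : K :=
  \tr (tl_ricci_mixed g p *m tl_ricci_mixed g p *m tl_ricci_mixed g p).

(* The monomials R^i S2^j S3^k being independent, a density is a polynomial in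
   three variables standing for R, S2, S3.  [mnmwgt] gives the variables the
   weights 1, 2, 3, so that [mnmwgt] of R^i S2^j S3^k is i + 2 j + 3 k. *)

Definition varR (K : realType) : {mpoly K[3]} := 'X_(inord 0).
Definition varS2 (K : realType) : {mpoly K[3]} := 'X_(inord 1).
Definition varS3 (K : realType) : {mpoly K[3]} := 'X_(inord 2).

Definition is_density (K : realType) (n : nat) (L : {mpoly K[3]}) : Prop :=
  L \is n.-homog for (@mnmwgt 3).

Definition num_monomials (n : nat) : nat :=
  #|[set m : 'I_n.+1 * 'I_n.+1 * 'I_n.+1 |
      (m.1.1 + 2 * m.1.2 + 3 * m.2 == n)%N]|.

Definition eval_density (K : realType) (L : {mpoly K[3]}) (R S2 S3 : K) : K :=
  L.@[tnth [tuple R; S2; S3]].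

Definition density_on (K : realType) (g : 'rV[K]_3 -> 'M[K]_3)
    (L : {mpoly K[3]}) (p : 'rV[K]_3) : K :=
  eval_density L (scalar_curv g p) (S2_curv g p) (S3_curv g p).

(* The ansatz dr^2 + a(r)^2 (- dt^2 + dx^2), in the coordinates (t, x, r). *)

Definition r_coord (K : realType) (p : 'rV[K]_3) : K := p 0 (inord 2).

Definition c_metric (K : realType) (a : K -> K) (p : 'rV[K]_3) : 'M[K]_3 :=
  diag_mx (\row_(i < 3)
    tnth [tuple - a (r_coord p) ^+ 2; a (r_coord p) ^+ 2; 1] i).

Definition smooth (K : realType) (a : K -> K) : Prop :=
  forall (n : nat) (r : K), derivable (derive1n n a) r 1.

(* [a] must not vanish, for the metric to be nondegenerate. *)
Definition scale_factor (K : realType) (a : K -> K) : Prop :=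
  smooth a /\ forall r, a r != 0.

(* F and G depend on the density only, not on [a]: the evaluation on the ansatz
   is an expression in a, a' and a'', of degree at most one in a''. *)
Definition simple_c_theorem (K : realType) (L : {mpoly K[3]}) : Prop :=
  exists F G : K -> K -> K, forall a : K -> K, scale_factor a ->
    forall p : 'rV[K]_3, let r := r_coord p in
      density_on (c_metric a) L p
      = F (a r) (derive1 a r) + G (a r) (derive1 a r) * derive1n 2 a r.

Definition trivial_c_theorem (K : realType) (L : {mpoly K[3]}) : Prop :=
  forall a : K -> K, scale_factor a ->
    forall p : 'rV[K]_3, density_on (c_metric a) L p = 0.

Definition C_formula (K : realType) (n : nat) (R S2 S3 : K) : K :=
  let s := Num.sqrt (24 * S2) in
  let t := Num.sqrt 6 * S3 / S2 `^ (3 / 2) in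
  3 * (-1) ^+ n / (4 * 6 ^+ n * n%:R) *
    ((R + s) ^+ n.-1 * (R - (n.-1)%:R * s) * (1 - t)
     + (R - s) ^+ n.-1 * (R + (n.-1)%:R * s) * (1 + t)).

(* The order-n polynomial which equals the formula; the restriction S2 > 0 is
   the domain on which the formula makes literal sense, and an open set of
   values determines the polynomial. *)
Definition is_C_density (K : realType) (n : nat) (C : {mpoly K[3]}) : Prop :=
  is_density n C /\
  forall R S2 S3 : K, 0 < S2 -> eval_density C R S2 S3 = C_formula n R S2 S3.

Definition Y6 (K : realType) : {mpoly K[3]} :=
  6%:R *: varS3 K ^+ 2 - varS2 K ^+ 3.

(* [P] is the underlying set of a subspace of dimension d: it contains d
   linearly independent vectors, and their span contains it. *)
Definition has_dimension (K : realType) (V : lmodType K) (P : V -> Prop)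
    (d : nat) : Prop :=
  exists B : 'I_d -> V,
    [/\ forall i, P (B i),
        forall c : 'I_d -> K, \sum_i c i *: B i = 0 -> forall i, c i = 0
      & forall v, P v -> exists c : 'I_d -> K, v = \sum_i c i *: B i].

(* Main.v *)
Require Import Defs.
From mathcomp Require Import all_boot all_order all_algebra.
From mathcomp Require Import mpoly.
From mathcomp Require Import boolp classical_sets reals topology normedtype.
From mathcomp Require Import derive sequences realfun exp.
From mathcomp Require Import ring zify.
Set Implicit Arguments. Unset Strict Implicit. Unset Printing Implicit Defensive.
Import Order.TTheory GRing.Theory Num.Theory numFieldNormedType.Exports.
Local Open Scope ring_scope.

(* On the ansatz, with x = (a'/a)^2 and d = x - a''/a, one has R = 4 d - 6 x,
   S2 = 2/3 d^2 and S3 = 2/9 d^3.  Dividing by Y6 in the variable S3 writes an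
   order-n density as Y6 M plus a combination of one monomial for each power
   d^e, 0 <= e <= n, e <> 1.  These restrict to multiples of
   (4 d - 6 x)^(n - e) d^e, which are linearly independent, so the trivial
   densities are the multiples of Y6.  Scale factors with a = a' = 1 and a''
   arbitrary at a point show that a density satisfies the simple c-theorem only
   if its restriction to x = 1 is affine in d; as the term e = 1 is missing, the
   constant coefficient determines the linear one, so this leaves one
   restriction up to scaling, that of C_(n). *)

Local Notation o0 := (@Ordinal 3 0 isT).
Local Notation o1 := (@Ordinal 3 1 isT).
Local Notation o2 := (@Ordinal 3 2 isT).

Lemma ord3_ind (P : 'I_3 -> Prop) : P o0 -> P o1 -> P o2 -> forall i, P i.
Proof.
move=> P0 P1 P2 [[|[|[|//]]] lt_i3].
- by rewrite (_ : Ordinal _ = o0) //; apply: val_inj.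
- by rewrite (_ : Ordinal _ = o1) //; apply: val_inj.
- by rewrite (_ : Ordinal _ = o2) //; apply: val_inj.
Qed.

Lemma big_ord3 (V : Type) (idx : V) (op : Monoid.law idx) (F : 'I_3 -> V) :
  \big[op/idx]_(i < 3) F i = op (op (F o0) (F o1)) (F o2).
Proof.
rewrite !big_ord_recl big_ord0 Monoid.mulm1 Monoid.mulmA.
by congr (op (op (F _) (F _)) (F _)); apply: val_inj.
Qed.

Lemma inord3 : (inord 0 = o0) * (inord 1 = o1) * (inord 2 = o2).
Proof. by split; [split|]; apply: val_inj; rewrite /= inordK. Qed.

Definition on_ansatz (K : realType) (L : {mpoly K[3]}) (x d : K) : K :=
  eval_density L (4 * d - 6 * x) (2 / 3 * d ^+ 2) (2 / 9 * d ^+ 3).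

(** * Curvature of the ansatz *)

Section Curvature.
Variable K : realType.

(** Along t and x the difference quotient is the zero function; along r it is the quotient that
    defines [derive1]. *)
Lemma partial_r_coord (h : K -> K) k p :
  partial k (fun q => h (r_coord q)) p
    = if k == o2 then derive1 h (r_coord p) else 0.
Proof.
rewrite /partial /derive /derive1 /r_coord; case: eqP => [->|/eqP k2].
  rewrite (_ : (fun x : K => _) = fun x =>
      x^-1 *: (h (x + p 0 (inord 2)) - h (p 0 (inord 2)))) //.
  by apply/funext => x /=; rewrite !mxE inord3 !eqxx mulr1.
rewrite (_ : (fun x : K => _) = fun=> 0); last first.
  apply/funext => x /=; rewrite !mxE inord3 eqxx /= eq_sym (negbTE k2).
  by rewrite mulr0 add0r subrr scaler0.
by apply: lim_cst; exact: (@norm_hausdorff _ K^o).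
Qed.

Variable a : K -> K.
Hypothesis a_scale : scale_factor a.

Lemma scale_factor_neq0 r : a r != 0.
Proof. by case: a_scale. Qed.

Lemma scale_factor_derivable n (r : K) : derivable (derive1n n a) r 1.
Proof. by case: a_scale => sm _; apply: sm. Qed.

Let d1 : K -> K := derive1 a.
Let d2 : K -> K := derive1n 2 a.

Let is_derive_a (r : K) : is_derive r 1 a (d1 r).
Proof.
split; first exact: (@scale_factor_derivable 0%N).
by rewrite /d1 derive1E.
Qed.

Let is_derive_d1 (r : K) : is_derive r 1 d1 (d2 r).
Proof.
split; first exact: (@scale_factor_derivable 1%N).
by rewrite /d2 /= derive1E.
Qed.

Let ginv p : 'M[K]_3 := diag_mx (\row_(i < 3)
  tnth [tuple - a (r_coord p) ^- 2; a (r_coord p) ^- 2; 1] i).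

Let c_metric_mulV p : c_metric a p *m ginv p = 1%:M.
Proof.
have a0 := scale_factor_neq0 (r_coord p).
rewrite /c_metric /ginv mulmx_diag; apply/matrixP => i j; rewrite !mxE.
congr (_ *+ _); move: i {j}; apply: ord3_ind; rewrite !(tnth_nth 0) /=.
- by field.
- by field.
- by rewrite mulr1.
Qed.

Lemma c_metric_unit p : c_metric a p \in unitmx.
Proof. by have [] := mulmx1_unit (c_metric_mulV p). Qed.

Lemma inv_c_metric p : invmx (c_metric a p) = ginv p.
Proof.
by rewrite -[RHS](mulKmx (c_metric_unit p)) c_metric_mulV mulmx1.
Qed.

(* Christoffel symbols are [chr_rad] times a a' plus [chr_log] times a' / a;
   the radial ones have upper index r. *)
Definition chr_rad (i j k : nat) : K :=
  ((i == 2) && (j == k))%:R * (nth 0 [:: 1; -1; 0] j).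
Definition chr_log (i j k : nat) : K :=
  (i != 2)%:R * (((j == 2) && (i == k))%:R + ((k == 2) && (i == j))%:R).

Let is_derive_sqr (r : K) : is_derive r 1 (fun r => a r ^+ 2) (2 * (a r * d1 r)).
Proof.
apply: (is_derive_eq (is_deriveM (is_derive_a r) (is_derive_a r))).
by rewrite /GRing.scale /=; ring.
Qed.

Let is_derive_rad (r : K) : is_derive r 1 (fun r => a r * d1 r) (d1 r ^+ 2 + a r * d2 r).
Proof.
apply: (is_derive_eq (is_deriveM (is_derive_a r) (is_derive_d1 r))).
by rewrite /GRing.scale /=; ring.
Qed.

Let is_derive_log (r : K) : is_derive r 1 (fun r => d1 r / a r)
  (d2 r / a r - (d1 r / a r) ^+ 2).
Proof.
have a0 := scale_factor_neq0 r.
apply: (is_derive_eq (is_deriveM (is_derive_d1 r) (is_deriveV a0 (is_derive_a r)))).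
by rewrite /GRing.scale /=; field.
Qed.

Lemma partial_c_metric i j k p :
  partial k (fun q => c_metric a q i j) p =
    ((k == 2 :> nat) && (i == j))%:R * nth 0 [:: -2; 2; 0] i
      * (a (r_coord p) * d1 (r_coord p)).
Proof.
(* Writing every diagonal entry as [c i * a ^+ 2 + e i] lets one derivative serve all three. *)
pose c : 'I_3 -> K := fun i => nth 0 [:: -1; 1; 0] i.
pose e : 'I_3 -> K := fun i => nth 0 [:: 0; 0; 1] i.
pose f r : K := (i == j)%:R * (c i * a r ^+ 2 + e i).
rewrite (_ : (fun q => _) = fun q => f (r_coord q)).
  rewrite (partial_r_coord f) -val_eqE /=; case: eqP => _; last by rewrite !mul0r.
  rewrite derive1E.
  have /@derive_val -> := is_deriveZ (i == j)%:R
    (is_deriveD (is_deriveZ (c i) (is_derive_sqr (r_coord p)))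
    (is_derive_cst (e i) (r_coord p) 1)).
  rewrite /GRing.scale /= addr0 /c mulrA -mulrA -!mulrA; congr (_ * _).
  by move: i {j c e f}; apply: ord3_ind => /=; ring.
apply/funext => q; rewrite !mxE (tnth_nth 0) -mulr_natl /f /c /e; congr (_ * _).
by move: i {j c e f}; apply: ord3_ind => /=; ring.
Qed.

Lemma christoffel_c_metric i j k :
  christoffel (c_metric a) i j k = fun p =>
    chr_rad i j k * (a (r_coord p) * d1 (r_coord p))
    + chr_log i j k * (d1 (r_coord p) / a (r_coord p)).
Proof.
apply/funext => p; have a0 := scale_factor_neq0 (r_coord p).
rewrite /christoffel inv_c_metric big_ord3 !partial_c_metric !mxE.
rewrite !(tnth_nth 0) /chr_rad /chr_log.
by move: i j k; do 3 (apply: ord3_ind); rewrite /= ?mulr0n ?mulr1n; field.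
Qed.

Lemma partial_christoffel i j k l p :
  partial l (christoffel (c_metric a) i j k) p =
    (l == 2 :> nat)%:R *
    (chr_rad i j k * (d1 (r_coord p) ^+ 2 + a (r_coord p) * d2 (r_coord p))
    + chr_log i j k *
      (d2 (r_coord p) / a (r_coord p) - (d1 (r_coord p) / a (r_coord p)) ^+ 2)).
Proof.
rewrite christoffel_c_metric (partial_r_coord (fun r =>
  chr_rad i j k * (a r * d1 r) + chr_log i j k * (d1 r / a r))).
rewrite -val_eqE /=; case: eqP => _; last by rewrite mul0r.
rewrite derive1E mul1r.
by have /@derive_val -> := is_deriveD
    (is_deriveZ (chr_rad i j k) (is_derive_rad (r_coord p)))
    (is_deriveZ (chr_log i j k) (is_derive_log (r_coord p))).
Qed.

Lemma ricci_c_metric p : let r := r_coord p in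
  ricci (c_metric a) p = diag_mx (\row_(i < 3)
    tnth [tuple a r * d2 r + d1 r ^+ 2; - (a r * d2 r + d1 r ^+ 2);
                - (2 * (d2 r / a r))] i).
Proof.
move=> r; have a0 : a r != 0 := scale_factor_neq0 _.
(* The symbols become an opaque [G]. Its partial derivatives are rewritten before [G] itself, which
   [GE] would otherwise expand inside them. *)
have := partial_christoffel; have := christoffel_c_metric; rewrite /ricci.
move: (christoffel (c_metric a)) => G GE dG.
apply/matrixP => j k; rewrite !mxE (tnth_nth 0) !big_ord3 !dG !GE.
rewrite -/r /chr_rad /chr_log.
by move: j k; do 2 (apply: ord3_ind); rewrite /= ?mulr0n ?mulr1n; field.
Qed.

(** The mixed traceless Ricci tensor is d times diag(-1/3, -1/3, 2/3), so S2 and S3 are d^2 and d^3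
    times the sums of squares and cubes of these entries. *)
Lemma curv_c_metric p : let r := r_coord p in
  let x := (d1 r / a r) ^+ 2 in let d := x - d2 r / a r in
  [/\ scalar_curv (c_metric a) p = 4 * d - 6 * x,
      S2_curv (c_metric a) p = 2 / 3 * d ^+ 2
    & S3_curv (c_metric a) p = 2 / 9 * d ^+ 3].
Proof.
move=> r x d; have a0 : a r != 0 := scale_factor_neq0 _.
have RE : scalar_curv (c_metric a) p = 4 * d - 6 * x.
  rewrite /scalar_curv ricci_c_metric inv_c_metric mulmx_diag mxtrace_diag.
  by rewrite big_ord3 !mxE !(tnth_nth 0) /= -/r /d /x; field.
have SE : tl_ricci_mixed (c_metric a) p = diag_mx (\row_(i < 3)
    (nth 0 [:: -3^-1; -3^-1; 2 / 3] i * d)).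
  rewrite /tl_ricci_mixed /tl_ricci mulmxBl -scalemxAl mulmxV ?c_metric_unit //.
  rewrite RE ricci_c_metric inv_c_metric mulmx_diag.
  apply/matrixP => i j; rewrite !mxE !(tnth_nth 0) -/r /d /x.
  by move: i j; do 2 (apply: ord3_ind); rewrite /= ?mulr0n ?mulr1n; field.
split=> //.
  by rewrite /S2_curv SE mulmx_diag mxtrace_diag big_ord3 !mxE /=; field.
by rewrite /S3_curv SE !mulmx_diag mxtrace_diag big_ord3 !mxE /=; field.
Qed.

End Curvature.

(** * Scale factors with a prescribed second-order jet *)

Section ScaleFactors.
Variable K : realType.

(** The functions q e^p with p and q polynomials are closed under differentiation, which gives
    smoothness and all derivatives at once. *)
Lemma is_derive_poly_expR (p q : {poly K}) (r : K) :
  is_derive r 1 (fun x => q.[x] * expR p.[x])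
    ((q^`() + q * p^`()).[r] * expR p.[r]).
Proof.
apply: (is_derive_eq (is_deriveM (is_derive_poly q r)
  (is_derive1_comp (is_derive_expR p.[r]) (is_derive_poly p r)))).
rewrite !hornerE /GRing.scale /=.
rewrite -[LHS]/(q.[r] * (expR p.[r] * p^`().[r]) + expR p.[r] * q^`().[r]).
by ring.
Qed.

Lemma derive1n_poly_expR (p q : {poly K}) n :
  derive1n n (fun x : K => q.[x] * expR p.[x] : K)
    = fun x => (iter n (fun s => s^`() + s * p^`()) q).[x] * expR p.[x].
Proof.
elim: n => [//|n IHn]; rewrite derive1nS IHn; apply/funext => x.
rewrite derive1E /=.
by have /@derive_val -> := is_derive_poly_expR p
  (iter n (fun s => s^`() + s * p^`()) q) x.
Qed.

Lemma scale_factor_jet (d : K) : exists2 a : K -> K, scale_factor a &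
  [/\ a 0 = 1, derive1 a 0 = 1 & derive1n 2 a 0 = 1 - d].
Proof.
(* The factor e^p never vanishes; p'(0) = 1 and p''(0) = - d give a'(0) = 1 and a''(0) = p''(0) +
   p'(0)^2 = 1 - d. *)
pose p : {poly K} := 'X - (d / 2)%:P * 'X * 'X.
pose a (x : K) := (1 : {poly K}).[x] * expR p.[x].
have p0 : p.[0] = 0 by rewrite /p !hornerE /=; ring.
exists a; first split=> [n r|r].
- rewrite (derive1n_poly_expR p 1 n).
  by have [] := is_derive_poly_expR p (iter n (fun s => s^`() + s * p^`()) 1) r.
- by rewrite /a hornerE mul1r gt_eqF // expR_gt0.
split.
- by rewrite /a hornerE p0 expR0 mulr1.
- rewrite -derive1n1 (derive1n_poly_expR p 1 1) p0 expR0 /= /p.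
  by rewrite !(poly.derivE, hornerE) /=; ring.
rewrite (derive1n_poly_expR p 1 2) p0 expR0 /= /p.
by rewrite !(poly.derivE, hornerE) /=; field.
Qed.
End ScaleFactors.

(** * Restriction of densities to the ansatz *)

Section Restriction.
Variable K : realType.
Implicit Type L : {mpoly K[3]}.

Lemma density_on_c_metric L (a : K -> K) (p : 'rV[K]_3) : scale_factor a ->
  let r := r_coord p in let x := (derive1 a r / a r) ^+ 2 in
  density_on (c_metric a) L p = on_ansatz L x (x - derive1n 2 a r / a r).
Proof. by move=> sa; rewrite /density_on; have [-> -> ->] := curv_c_metric sa p. Qed.

(** As F and G do not depend on the scale factor, the jets (1, 1, 1 - d) all share the values F 1 1
    and G 1 1, and the evaluation is F 1 1 + G 1 1 (1 - d). *)
Lemma simple_c_theorem_affine L : simple_c_theorem L ->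
  exists u v, forall d, on_ansatz L 1 d = u + v * d.
Proof.
case=> F [G FG]; exists (F 1 1 + G 1 1), (- G 1 1) => d.
have [a sa [a0 a1 a2]] := scale_factor_jet d.
have := FG a sa 0; rewrite density_on_c_metric //=.
have -> : r_coord (0 : 'rV[K]_3) = 0 by rewrite /r_coord mxE.
move: a2 => /= ->; rewrite a0 a1 !divr1 expr1n.
by rewrite (_ : 1 - (1 - d) = d) => [->|]; ring.
Qed.

Lemma trivial_c_theorem_eq0 L d : trivial_c_theorem L -> on_ansatz L 1 d = 0.
Proof.
have [a sa [a0 a1 a2]] := scale_factor_jet d.
move=> /(_ a sa 0); rewrite density_on_c_metric //=.
have -> : r_coord (0 : 'rV[K]_3) = 0 by rewrite /r_coord mxE.
move: a2 => /= ->; rewrite a0 a1 !divr1 expr1n.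
by rewrite (_ : 1 - (1 - d) = d) => [->|]; ring.
Qed.
End Restriction.

(** * Densities and C_(n) *)

Section Densities.
Variable K : realType.
Implicit Types (L M : {mpoly K[3]}) (R u t x d : K).

Lemma is_densityD n L M : is_density n L -> is_density n M -> is_density n (L + M).
Proof. exact: dhomogD. Qed.

Lemma is_densityZ n c L : is_density n L -> is_density n (c *: L).
Proof. exact: dhomogZ. Qed.

Lemma is_densityB n L M : is_density n L -> is_density n M -> is_density n (L - M).
Proof. by move=> hL hM; apply: is_densityD => //; rewrite /is_density dhomogN. Qed.

Lemma is_density0 n : is_density n (0 : {mpoly K[3]}).
Proof. exact: dhomog0. Qed.

Lemma is_densityM m n L M :
  is_density m L -> is_density n M -> is_density (m + n) (L * M).
Proof. exact: dhomogM. Qed.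

Lemma is_density_varR : is_density 1 (varR K).
Proof. by rewrite /is_density dhomogX; apply/eqP; rewrite [LHS]mnmwgt1 inord3. Qed.

Lemma is_density_varS2 : is_density 2 (varS2 K).
Proof. by rewrite /is_density dhomogX; apply/eqP; rewrite [LHS]mnmwgt1 inord3. Qed.

Lemma is_density_varS3 : is_density 3 (varS3 K).
Proof. by rewrite /is_density dhomogX; apply/eqP; rewrite [LHS]mnmwgt1 inord3. Qed.

Lemma is_density_Y6 : is_density 6 (Y6 K).
Proof.
apply: is_densityB; last exact: (dhomogMn 3 is_density_varS2).
exact: is_densityZ (dhomogMn 2 is_density_varS3).
Qed.

Definition monomial i j k : {mpoly K[3]} :=
  varR K ^+ i * varS2 K ^+ j * varS3 K ^+ k.

Lemma is_density_monomial i j k : is_density (i + 2 * j + 3 * k) (monomial i j k).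
Proof.
do 2?apply: is_densityM.
- by have := dhomogMn i is_density_varR; rewrite mul1n.
- exact: (dhomogMn j is_density_varS2).
- exact: (dhomogMn k is_density_varS3).
Qed.

Lemma mpolyX_monomial (m : 'X_{1..3}) : 'X_[m] = monomial (m o0) (m o1) (m o2).
Proof. by rewrite mpolyXE_id big_ord3 /monomial /varR /varS2 /varS3 !inord3. Qed.

Lemma mnmwgt3 (m : 'X_{1..3}) : mnmwgt m = (m o0 + 2 * m o1 + 3 * m o2)%N.
Proof. by rewrite /mnmwgt big_ord3 /= muln1 ![(m _ * _)%N]mulnC. Qed.

Lemma density_ind n (P : {mpoly K[3]} -> Prop) :
    P 0 -> (forall c L M, P L -> P M -> P (c *: L + M)) ->
    (forall i j k, (i + 2 * j + 3 * k)%N = n -> P (monomial i j k)) ->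
  forall L, is_density n L -> P L.
Proof.
move=> P0 PD PX L /dhomogP hL; rewrite (mpolyE L).
(* The induction runs over a sublist of the support, while the coefficients stay those of [L]. *)
have : {subset msupp L <= msupp L} by [].
elim: {-2}(msupp L) => [_|m s IHs sL]; first by rewrite big_nil.
rewrite big_cons; apply: PD; last by apply: IHs => m' m's; rewrite sL ?inE ?m's ?orbT.
rewrite mpolyX_monomial; apply: PX; rewrite -mnmwgt3.
by apply: hL; rewrite sL ?mem_head.
Qed.

Lemma eval_densityD L M R S2 S3 :
  eval_density (L + M) R S2 S3 = eval_density L R S2 S3 + eval_density M R S2 S3.
Proof. exact: mevalD. Qed.

Lemma eval_densityB L M R S2 S3 :
  eval_density (L - M) R S2 S3 = eval_density L R S2 S3 - eval_density M R S2 S3.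
Proof. exact: mevalB. Qed.

Lemma eval_densityZ c L R S2 S3 :
  eval_density (c *: L) R S2 S3 = c * eval_density L R S2 S3.
Proof. exact: mevalZ. Qed.

Lemma eval_densityM L M R S2 S3 :
  eval_density (L * M) R S2 S3 = eval_density L R S2 S3 * eval_density M R S2 S3.
Proof. exact: mevalM. Qed.

Lemma eval_densityX L n R S2 S3 :
  eval_density (L ^+ n) R S2 S3 = eval_density L R S2 S3 ^+ n.
Proof. exact: rmorphXn. Qed.

Lemma eval_density0 R S2 S3 : eval_density 0 R S2 S3 = 0.
Proof. exact: meval0. Qed.

Lemma eval_density1 R S2 S3 : eval_density 1 R S2 S3 = 1.
Proof. exact: meval1. Qed.

Lemma eval_density_sum I (r : seq I) (F : I -> {mpoly K[3]}) R S2 S3 :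
  eval_density (\sum_(i <- r) F i) R S2 S3
    = \sum_(i <- r) eval_density (F i) R S2 S3.
Proof. exact: raddf_sum. Qed.

Lemma eval_density_var R S2 S3 :
  (eval_density (varR K) R S2 S3 = R) * (eval_density (varS2 K) R S2 S3 = S2)
  * (eval_density (varS3 K) R S2 S3 = S3).
Proof.
by rewrite /eval_density /varR /varS2 /varS3 !mevalXU !inord3 !(tnth_nth 0).
Qed.

Definition eval_densityE := (eval_densityB, eval_densityD, eval_densityZ,
  eval_densityM, eval_densityX, eval_density0, eval_density1, eval_density_var).

Lemma on_ansatz_Y6 x d : on_ansatz (Y6 K) x d = 0.
Proof. by rewrite /on_ansatz /Y6 !eval_densityE; field. Qed.

(* With u ^ 2 = 24 S2, the triple evaluates to P, Q, W where
   (R + u) ^ m = P + u Q and R Q - m P = u ^ 2 W. *)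
Fixpoint binomial_parts m : {mpoly K[3]} * {mpoly K[3]} * {mpoly K[3]} :=
  if m is m'.+1 then
    let: (P, Q, W) := binomial_parts m' in
    (varR K * P + 24 *: (varS2 K * Q), P + varR K * Q,
     varR K * W - m'.+1%:R *: Q)
  else (1, 0, 0).

(** The closed formula with its roots eliminated. For m = n - 1, (R + u)^m (R - m u) = A + u B with
    A = R P - m u^2 Q and B = R Q - m P = u^2 W, so the braces equal 2 A - 2 u t B = 2 A - 2 u^3 t
    W. Here u^2 = 24 S2 and u^3 t = 288 S3. *)
Definition C_density n : {mpoly K[3]} :=
  let: (P, Q, W) := binomial_parts n.-1 in
  (3 * (-1) ^+ n / (4 * 6 ^+ n * n%:R)) *:
    (2 *: (varR K * P - n.-1%:R *: (24 *: (varS2 K * Q)))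
     - 576 *: (varS3 K * W)).

Lemma binomial_parts_density m : let: (P, Q, W) := binomial_parts m in
  [/\ is_density m P, is_density m.-1 Q, is_density m.+1 (varS2 K * Q)
    & is_density m.+1 (varS3 K * W)].
Proof.
(* Q and W have orders m - 1 and m - 2. The disjunctions record that they vanish where these
   subtractions would truncate. *)
suff: let: (P, Q, W) := binomial_parts m in
  [/\ is_density m P, Q = 0 \/ exists2 k, m = k.+1 & is_density k Q
    & W = 0 \/ exists2 k, m = k.+2 & is_density k W].
  case: (binomial_parts m) => [[P Q] W] [hP hQ hW]; split=> //.
  - by case: hQ => [->|[k -> //]]; exact: is_density0.
  - case: hQ => [->|[k -> hQ]]; first by rewrite mulr0; exact: is_density0.
    exact: is_densityM is_density_varS2 hQ.
  - case: hW => [->|[k -> hW]]; first by rewrite mulr0; exact: is_density0.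
    exact: is_densityM is_density_varS3 hW.
elim: m => [|m] /=.
  by split; [exact: dhomog1 | left | left].
case: (binomial_parts m) => [[P Q] W] [hP hQ hW]; split.
- apply: is_densityD; first exact: is_densityM is_density_varR hP.
  apply: is_densityZ; case: hQ => [->|[k -> hQ]].
    by rewrite mulr0; exact: is_density0.
  exact: is_densityM is_density_varS2 hQ.
- right; exists m => //; apply: is_densityD => //.
  case: hQ => [->|[k -> hQ]]; first by rewrite mulr0; exact: is_density0.
  exact: is_densityM is_density_varR hQ.
- case: hQ => [Q0|[k mE hQ]].
    case: hW => [->|[k mE hW]]; first by left; rewrite Q0 mulr0 scaler0 subrr.
    right; exists k.+1; first by rewrite mE.
    rewrite Q0 scaler0 subr0; exact: is_densityM is_density_varR hW.
  right; exists k; first by rewrite mE.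
  apply: is_densityB; last exact: is_densityZ.
  case: hW => [->|[l]]; first by rewrite mulr0; exact: is_density0.
  by rewrite mE => -[->] hW; exact: is_densityM is_density_varR hW.
Qed.

Lemma is_density_C n : (0 < n)%N -> is_density n (C_density n).
Proof.
case: n => // n _; rewrite /C_density /=.
have := binomial_parts_density n.
case: (binomial_parts n) => [[P Q] W] [hP _ hQ hW].
apply/is_densityZ/is_densityB; apply: is_densityZ => //.
apply: is_densityB; first exact: is_densityM is_density_varR hP.
by do 2!apply: is_densityZ.
Qed.

(** The recursion for W rests on R (P + R Q) - (m + 1) (R P + u^2 Q) = R (R Q - m P) - (m + 1) u^2
    Q. *)
Lemma eval_binomial_parts m R S2 S3 u : u ^+ 2 = 24 * S2 ->
  let: (P, Q, W) := binomial_parts m in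
  [/\ (R + u) ^+ m = eval_density P R S2 S3 + u * eval_density Q R S2 S3,
      (R - u) ^+ m = eval_density P R S2 S3 - u * eval_density Q R S2 S3
    & R * eval_density Q R S2 S3 - m%:R * eval_density P R S2 S3
        = u ^+ 2 * eval_density W R S2 S3].
Proof.
move=> u2; have uE q : 24 * (S2 * q) = u ^+ 2 * q by rewrite u2 mulrA.
elim: m => [|m]; first by rewrite /= !eval_densityE; split; ring.
move=> /=; case: (binomial_parts m) => [[P Q] W] [hp hm hW].
rewrite !eval_densityE ![_ ^+ m.+1]exprS hp hm uE -natr1; split; [ring | ring |].
by rewrite mulrBr [u ^+ 2 * (R * _)]mulrCA -hW; ring.
Qed.

(** Any u and t satisfying the two equations are allowed, so u may be either root of 24 S2 and S2
    may vanish. *)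
Lemma eval_C_density n R S2 S3 u t : u ^+ 2 = 24 * S2 -> u ^+ 3 * t = 288 * S3 ->
  eval_density (C_density n) R S2 S3 =
    3 * (-1) ^+ n / (4 * 6 ^+ n * n%:R) *
    ((R + u) ^+ n.-1 * (R - n.-1%:R * u) * (1 - t)
     + (R - u) ^+ n.-1 * (R + n.-1%:R * u) * (1 + t)).
Proof.
move=> u2 u3; have := eval_binomial_parts n.-1 R S3 u2.
rewrite /C_density; case: (binomial_parts n.-1) => [[P Q] W] [-> -> hW].
rewrite !eval_densityE; congr (_ * _).
move: (eval_density P _ _ _) (eval_density Q _ _ _) (eval_density W _ _ _) hW.
move=> p q w hW; rewrite [24 * _]mulrA -u2.
rewrite (_ : 576 * (S3 * w) = 2 * (288 * S3) * w); last by ring.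
rewrite -u3 (_ : 2 * _ * w = 2 * u * t * (u ^+ 2 * w)); last by ring.
by rewrite -hW; ring.
Qed.

Lemma is_C_density_C n : (0 < n)%N -> is_C_density n (C_density n).
Proof.
move=> n0; split=> [|R S2 S3 S2_gt0]; first exact: is_density_C.
have S2_ge0 := ltW S2_gt0.
have s6 : Num.sqrt 6 ^+ 2 = 6 :> K by rewrite sqr_sqrtr.
have s2 : Num.sqrt S2 ^+ 2 = S2 by rewrite sqr_sqrtr.
have s_neq0 : Num.sqrt S2 != 0 by rewrite sqrtr_eq0 -ltNge.
have s24 : Num.sqrt (24 * S2) = 2 * Num.sqrt 6 * Num.sqrt S2.
  rewrite (_ : 24 * S2 = 2 ^+ 2 * (6 * S2)); last by ring.
  by rewrite sqrtrM ?sqr_ge0 // sqrtr_sqr normr_nat sqrtrM // mulrA.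
apply: eval_C_density; first by rewrite sqr_sqrtr // mulr_ge0.
have -> : S2 `^ (3 / 2) = Num.sqrt S2 ^+ 3.
  by rewrite mulrC powRrM powR12_sqrt // powR_mulrn ?sqrtr_ge0.
rewrite s24 !exprMn.
rewrite [LHS](_ : _ = 8 * (Num.sqrt 6 ^+ 2 * Num.sqrt 6 ^+ 2) * S3); last by field.
by rewrite s6; ring.
Qed.

Lemma on_ansatz_C n x d : (0 < n)%N ->
  on_ansatz (C_density n) x d = x ^+ n.-1 * (3 / (2 * n%:R) * x - d).
Proof.
case: n => // n _; rewrite /on_ansatz.
(* On the ansatz u = 4 d squares to 24 S2 whatever the sign of d, and goes with t = 1. The first
   summand drops out and R - u = - 6 x. *)
rewrite (@eval_C_density _ _ _ _ (4 * d) 1); [|by field|by field].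
rewrite subrr mulr0 add0r (_ : 4 * d - 6 * x - 4 * d = -1 * (6 * x)); last by ring.
rewrite /= !exprMn !exprS -[n.+1%:R]natr1.
have e1 : (-1) ^+ n * (-1) ^+ n = 1 :> K by rewrite -exprMn mulrNN mulr1 expr1n.
have e6 : (6 : K) ^+ n != 0 by rewrite expf_neq0 // pnatr_eq0.
have en : n%:R + 1 != 0 :> K by rewrite natr1 pnatr_eq0.
rewrite [LHS](_ : _ = ((-1) ^+ n * (-1) ^+ n) * (x ^+ n *
   (3 / (2 * (n%:R + 1)) * x - d))); last by field; rewrite en e6.
by rewrite e1 mul1r.
Qed.
End Densities.

(** * Reduction modulo Y6 *)

Section NormalForm.
Variable K : realType.
Implicit Types (L M : {mpoly K[3]}) (x d u v : K).

Lemma on_ansatzD L M x d : on_ansatz (L + M) x d = on_ansatz L x d + on_ansatz M x d.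
Proof. exact: eval_densityD. Qed.

Lemma on_ansatzB L M x d : on_ansatz (L - M) x d = on_ansatz L x d - on_ansatz M x d.
Proof. exact: eval_densityB. Qed.

Lemma on_ansatzZ c L x d : on_ansatz (c *: L) x d = c * on_ansatz L x d.
Proof. exact: eval_densityZ. Qed.

Lemma on_ansatz_Y6M M x d : on_ansatz (Y6 K * M) x d = 0.
Proof. by rewrite /on_ansatz eval_densityM -/(on_ansatz _ _ _) on_ansatz_Y6 mul0r. Qed.

(* The monomial of degree at most one in S3 whose evaluation on the ansatz is
   a multiple of d ^ e; there is none for e = 1, where the value is junk. *)
Definition reduced_monomial n e : {mpoly K[3]} :=
  if odd e then monomial K (n - e) (e - 3)./2 1 else monomial K (n - e) e./2 0.

Lemma on_ansatz_reduced_monomial e : exists2 w : K, w != 0 &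
  forall n x d, e != 1%N ->
    on_ansatz (reduced_monomial n e) x d = w * ((4 * d - 6 * x) ^+ (n - e) * d ^+ e).
Proof.
have w2 k : (2 / 3 : K) ^+ k != 0 by rewrite expf_neq0 // mulf_neq0 ?invr_eq0 ?pnatr_eq0.
have w3 : (2 / 9 : K) != 0 by rewrite mulf_neq0 ?invr_eq0 ?pnatr_eq0.
exists (if odd e then (2 / 3) ^+ (e - 3)./2 * (2 / 9) else (2 / 3) ^+ e./2).
  by case: ifP => _ //; rewrite mulf_neq0.
move=> n x d e1; rewrite /on_ansatz /reduced_monomial /monomial.
case: ifP => e_odd; rewrite !eval_densityE ?expr0 ?expr1 (exprMn _ (2 / 3)) -exprM.
  (* An odd e other than 1 is at least 3, so [e - 3] does not truncate. *)
  rewrite -[in d ^+ e](_ : 2 * (e - 3)./2 + 3 = e)%N; last by lia.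
  by rewrite exprD; ring.
rewrite (_ : 2 * e./2 = e)%N; last by lia.
by ring.
Qed.

(** For n < 6 the subtraction [n - 6] truncates to 0 and would admit constant cofactors; the second
    clause forces the cofactor to be 0 there. *)
Definition Y6_multiple n L := exists M,
  [/\ is_density (n - 6) M, (n < 6)%N -> M = 0 & L = Y6 K * M].

Lemma Y6_multiple0 n : Y6_multiple n 0.
Proof. by exists 0; split=> //; [exact: is_density0 | rewrite mulr0]. Qed.

Lemma Y6_multiple_lin n c L M :
  Y6_multiple n L -> Y6_multiple n M -> Y6_multiple n (c *: L + M).
Proof.
move=> [A [hA A0 ->]] [B [hB B0 ->]]; exists (c *: A + B); split.
- by apply: is_densityD => //; exact: is_densityZ.
- by move=> n6; rewrite A0 // B0 // scaler0 addr0.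
- by rewrite mulrDr scalerAr.
Qed.

(** The condition [c 1 = 0] discards the junk value of [reduced_monomial] at e = 1. *)
Definition reduction n L := exists2 c : nat -> K, c 1 = 0 &
  Y6_multiple n (L - \sum_(e < n.+1) c e *: reduced_monomial n e).

Lemma reduction_Y6_multiple n L : Y6_multiple n L -> reduction n L.
Proof.
by move=> YL; exists (fun=> 0) => //; rewrite big1 ?subr0 // => i _; rewrite scale0r.
Qed.

Lemma reduction_lin n c L M : reduction n L -> reduction n M -> reduction n (c *: L + M).
Proof.
move=> [a a1 hL] [b b1 hM]; exists (fun e => c * a e + b e).
  by rewrite a1 b1 mulr0 addr0.
have := Y6_multiple_lin c hL hM; congr (Y6_multiple n _).
under [in RHS]eq_bigr do rewrite scalerDl -scalerA.
by rewrite big_split /= -scaler_sumr scalerBr opprD addrACA.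
Qed.

Lemma reduction_reduced_monomial n e : (e <= n)%N -> e != 1 ->
  reduction n (reduced_monomial n e).
Proof.
move=> en e1; exists (fun f => (f == e)%:R); first by rewrite eq_sym (negbTE e1).
rewrite (bigD1 (Ordinal (en : e < n.+1)%N)) //= eqxx scale1r big1.
  by rewrite addr0 subrr; exact: Y6_multiple0.
by move=> i; rewrite -val_eqE /= => /negbTE ->; rewrite scale0r.
Qed.

(** Induction on the exponent of S3: substituting S3^2 = (Y6 + S2^3) / 6 lowers it by two and keeps
    the weight. *)
Lemma reduction_monomial i j k :
  reduction (i + 2 * j + 3 * k) (monomial K i j k).
Proof.
elim/ltn_ind: k i j => -[|[|k]] IHk i j.
- have := @reduction_reduced_monomial (i + 2 * j + 3 * 0) (2 * j).
  rewrite /reduced_monomial (_ : odd _ = false); last by lia.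
  rewrite (_ : (2 * j)./2 = j)%N; last by lia.
  rewrite (_ : i + 2 * j + 3 * 0 - 2 * j = i)%N; last by lia.
  by apply; lia.
- have := @reduction_reduced_monomial (i + 2 * j + 3 * 1) (2 * j + 3).
  rewrite /reduced_monomial (_ : odd _ = true); last by lia.
  rewrite (_ : (2 * j + 3 - 3)./2 = j)%N; last by lia.
  rewrite (_ : i + 2 * j + 3 * 1 - (2 * j + 3) = i)%N; last by lia.
  by apply; lia.
have -> : monomial K i j k.+2
    = 6^-1 *: (Y6 K * monomial K i j k) + (6^-1 *: monomial K i (j + 3) k + 0).
  rewrite addr0 -scalerDr (_ : _ + _ = 6%:R *: monomial K i j k.+2).
    by rewrite scalerA mulVf ?scale1r ?pnatr_eq0.
  rewrite /Y6 /monomial !scaler_nat [varS2 K ^+ (j + 3)]exprD.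
  rewrite [varS3 K ^+ k.+2]exprS [varS3 K ^+ k.+1]exprS.
  by ring.
rewrite (_ : i + 2 * j + 3 * k.+2 = i + 2 * (j + 3) + 3 * k)%N; last by lia.
apply: reduction_lin.
  apply: reduction_Y6_multiple; exists (monomial K i j k); split=> //; last by lia.
  have := is_density_monomial K i j k.
  by congr (is_density _ _); lia.
apply: reduction_lin; first exact: IHk.
exact/reduction_Y6_multiple/Y6_multiple0.
Qed.

Lemma density_reduction n L : is_density n L -> reduction n L.
Proof.
move: L; apply: density_ind.
- exact/reduction_Y6_multiple/Y6_multiple0.
- by move=> c L M; exact: reduction_lin.
- by move=> i j k <-; exact: reduction_monomial.
Qed.

(** Each [b e] is a reduction coefficient times a nonzero factor, so if all of them vanish, nothing
    is left besides the multiple of [Y6]. *)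
Lemma density_on_ansatz n L : is_density n L -> exists b : nat -> K,
  [/\ b 1 = 0,
      forall x d, on_ansatz L x d
        = \sum_(e < n.+1) b e * ((4 * d - 6 * x) ^+ (n - e) * d ^+ e)
    & (forall e, (e <= n)%N -> b e = 0) -> Y6_multiple n L].
Proof.
move=> /density_reduction [c c1 [M [hM M0 LM]]].
have /choice [w wE] : forall e, exists w : K, w != 0 /\ forall n x d, e != 1%N ->
    on_ansatz (reduced_monomial n e) x d
      = w * ((4 * d - 6 * x) ^+ (n - e) * d ^+ e).
  by move=> e; have [w w0 wE] := on_ansatz_reduced_monomial e; exists w.
exists (fun e => c e * w e); split; first by rewrite c1 mul0r.
- move=> x d.
  rewrite -[L](subrK (\sum_(e < n.+1) c e *: reduced_monomial n e)).
  rewrite on_ansatzD LM on_ansatz_Y6M add0r {1}/on_ansatz eval_density_sum.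
  apply: eq_bigr => e _; rewrite eval_densityZ -/(on_ansatz _ _ _) -mulrA.
  have [e1|e1] := eqVneq (e : nat) 1%N; first by rewrite e1 c1 !mul0r.
  by have [_ ->] := wE e.
move=> cw0; exists M; split=> //; rewrite -LM big1 ?subr0 // => e _.
have /eqP := cw0 e (leq_ord e); rewrite mulf_eq0.
by have [/negbTE -> _] := wE e; rewrite orbF => /eqP ->; rewrite scale0r.
Qed.

(** In characteristic zero the first [size p] natural numbers are distinct roots, too many for a
    nonzero [p]. *)
Lemma poly_eq0_pointwise (p : {poly K}) : (forall z, p.[z] = 0) -> p = 0.
Proof.
move=> p0; apply/eqP; apply: contraT => pn0.
have := @max_poly_roots _ p [seq i%:R | i <- iota 0 (size p)] pn0.
rewrite size_map size_iota ltnn; apply.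
- by apply/allP => z _; rewrite /root p0.
- by rewrite map_inj_uniq ?iota_uniq // => i j /eqP; rewrite eqr_nat => /eqP.
Qed.

(* The substitution z = d / (4 d - 6) turns the restriction to x = 1 into the
   polynomial with the coefficients b. *)
Lemma trivial_density n L : is_density n L ->
  (forall d, on_ansatz L 1 d = 0) -> Y6_multiple n L.
Proof.
move=> /density_on_ansatz [b [_ bE bY]] L0; apply: bY.
pose p : {poly K} := \poly_(e < n.+1) b e.
(* No d gives z = 1/4; the extra factor takes care of this point. *)
suff /poly_eq0_pointwise : forall z, (p * (4%:P * 'X - 1)).[z] = 0.
  move=> /eqP; rewrite mulf_eq0 => /orP[/eqP p0|/eqP X0] e en.
    by have /(congr1 (fun q : {poly K} => q`_e)) := p0; rewrite coef_poly ltnS en coef0.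
  have /(congr1 (fun q : {poly K} => q.[0])) := X0; rewrite !hornerE ?(mulr0, sub0r).
  by move/eqP; rewrite oppr_eq0 oner_eq0.
move=> z; rewrite !hornerE.
have [->|z4] := eqVneq (4 * z - 1) 0; first by rewrite mulr0.
(* For d = z / q one has 4 d - 6 = 1 / q, so multiplying by q^n turns the e-th term into b e z^e. *)
set q := (4 * z - 1) / 6.
have q0 : q != 0 by rewrite mulf_neq0 ?invr_eq0 ?pnatr_eq0.
have := L0 (z / q); rewrite bE => bz.
suff -> : p.[z] = q ^+ n * 0 by rewrite mulr0 mul0r.
rewrite -bz mulr_sumr /p horner_poly; apply: eq_bigr => e _.
rewrite mulrCA; congr (_ * _).
rewrite (_ : 4 * (z / q) - 6 * 1 = q^-1); last by rewrite /q; field.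
have -> : q ^+ n = q ^+ (n - e) * q ^+ e by rewrite -exprD subnK // leq_ord.
by rewrite (exprMn _ z) !exprVn; field; rewrite !expf_neq0.
Qed.

(* With the term e = 1 missing, only the e = 0 term (4 d - 6) ^ n could
   contribute to the coefficient of d, and it vanishes by the value at 0. *)
Lemma linear_density n L v : is_density n L ->
  (forall d, on_ansatz L 1 d = v * d) -> v = 0.
Proof.
move=> /density_on_ansatz [b [b1 bE _]] Lv.
pose p : {poly K} :=
  \sum_(e < n.+1) (b e *: (4%:P * 'X - 6%:P) ^+ (n - e)) * 'X^e.
have /poly_eq0_pointwise/eqP : forall d, (p - v%:P * 'X).[d] = 0.
  move=> d; rewrite !hornerE -Lv bE /p horner_sum.
  apply/eqP; rewrite subr_eq0; apply/eqP/eq_bigr => e _.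
  by rewrite !hornerE ?mulr1.
rewrite subr_eq0 => /eqP pE.
have b0 : b 0 = 0.
  have := Lv 0; rewrite bE big_ord_recl big1 => [|i _]; last first.
    by rewrite /= expr0n /= !mulr0.
  rewrite /= expr0 !mulr0 add0r addr0 mulr1 subn0 => /eqP.
  rewrite mulf_eq0 expf_eq0 mulr1 oppr_eq0 pnatr_eq0 andbF orbF.
  by move/eqP.
have /(congr1 (fun q : {poly K} => q`_1)) := pE.
rewrite coefCM coefX mulr1 => <-; rewrite /p coef_sum big1 // => e _.
rewrite coefMXn; case: ltnP => // e1.
case: (nat_of_ord e) e1 => [|[|//]] _; first by rewrite b0 scale0r coef0.
by rewrite b1 scale0r coef0.
Qed.

(** At x = 1, C_(n) restricts to 3 / (2 n) - d, so alpha = 2 n u / 3 cancels the constant term. What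
    remains is linear in d, hence zero by [linear_density]. *)
Lemma affine_density n L u v : (0 < n)%N -> is_density n L ->
  (forall d, on_ansatz L 1 d = u + v * d) ->
  exists alpha, Y6_multiple n (L - alpha *: C_density K n).
Proof.
move=> n0 hL Luv; pose alpha := 2 * n%:R * u / 3; exists alpha.
have nn0 : n%:R != 0 :> K by rewrite pnatr_eq0 -lt0n.
have hL' : is_density n (L - alpha *: C_density K n).
  by apply/is_densityB/is_densityZ/is_density_C.
have L'v d : on_ansatz (L - alpha *: C_density K n) 1 d = (v + alpha) * d.
  rewrite on_ansatzB on_ansatzZ on_ansatz_C // expr1n Luv /alpha.
  by field.
apply: trivial_density => // d.
by rewrite L'v (linear_density hL' L'v) mul0r.
Qed.
End NormalForm.

(** * Dimension count *)

Section Counting.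
Local Open Scope nat_scope.

Lemma sum_half_le m c N :
  \sum_(j < N) ((2 * j + c <= m)%N : nat)
    = if (c <= m)%N then minn N ((m - c)./2).+1 else 0.
Proof.
elim: N => [|N IHN]; first by rewrite big_ord0 min0n; case: ifP.
rewrite big_ord_recr /= IHN.
by case: ifP => cm; case Nm: (2 * N + c <= m)%N; rewrite /nat_of_bool; lia.
Qed.

Lemma sum_add_eq m c N :
  \sum_(i < N) ((i + c == m)%N : nat) = ((c <= m)%N && (m < c + N)%N : nat).
Proof.
elim: N => [|N IHN]; first by rewrite big_ord0 addn0; case: leqP.
rewrite big_ord_recr /= IHN; case: (leqP c m); case: (ltnP m (c + N));
  by case: (ltnP m (c + N.+1)); case: eqP => /=; lia.
Qed.

(** For each exponent k of S3, the exponent j of S2 ranges over 2 j <= n - 3 k, and the exponent of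
    R is then determined. *)
Lemma num_monomialsE n :
  num_monomials n
    = \sum_(0 <= k < n.+1) if (3 * k <= n)%N then ((n - 3 * k)./2).+1 else 0.
Proof.
rewrite /num_monomials -sum1_card big_mkcond big_mkord /=.
transitivity (\sum_(t : 'I_n.+1 * 'I_n.+1 * 'I_n.+1)
    ((t.1.1 + (2 * t.1.2 + 3 * t.2))%N == n : nat)).
  by apply: eq_bigr => t _; rewrite inE addnA; case: eqP.
rewrite -(pair_bigA _ (fun (t : 'I_n.+1 * 'I_n.+1) (k : 'I_n.+1) =>
  ((t.1 + (2 * t.2 + 3 * k))%N == n : nat))) /=.
rewrite exchange_big; apply: eq_bigr => k _ /=.
rewrite -(pair_bigA _ (fun i j : 'I_n.+1 => ((i + (2 * j + 3 * k))%N == n : nat))) /=.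
rewrite exchange_big /=.
transitivity (\sum_(j < n.+1) ((2 * j + 3 * k <= n)%N : nat)).
  by apply: eq_bigr => j _; rewrite sum_add_eq; lia.
by rewrite sum_half_le; case: ifP => // kn; apply/minn_idPr; lia.
Qed.

(** The terms k >= 2 for n + 6 are those for n, shifted by two, followed by zeros. The terms k = 0
    and k = 1 add up to n + 6 for either parity of n. *)
Lemma num_monomials_add6 n : num_monomials (n + 6) = (num_monomials n + (n + 6))%N.
Proof.
rewrite !num_monomialsE (big_cat_nat _ (n := 2)) //=; last by lia.
rewrite [in X in (X + _)%N]big_nat_recr //= big_nat1.
rewrite (_ : (n + 6).+1 = (n + 5).+2)%N; last by lia.
rewrite !big_add1 /= (big_cat_nat _ (n := n.+1)) //=; last by lia.
rewrite [X in (_ + (_ + X))%N]big1_seq => [|k]; last first.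
  by rewrite mem_index_iota => kn; rewrite ifF //; lia.
rewrite (_ : \sum_(0 <= i < n.+1) _ =
  \sum_(0 <= k < n.+1) if (3 * k <= n)%N then ((n - 3 * k)./2).+1 else 0).
  by rewrite ifT; lia.
apply: eq_bigr => k _; rewrite (_ : 3 * k.+2 = 3 * k + 6); last by lia.
by rewrite leq_add2r subnDr.
Qed.
End Counting.

(** * Bases of the densities and of the trivial densities *)

Section Dimension.
Variable K : realType.

Definition mnm3 (i j k : nat) : 'X_{1..3} := [multinom nth 0 [:: i; j; k] l | l < 3].

Lemma monomialE i j k : monomial K i j k = 'X_[mnm3 i j k].
Proof. by rewrite mpolyX_monomial !mnmE. Qed.

Lemma mnm3_inj i j k i' j' k' :
  mnm3 i j k = mnm3 i' j' k' -> [/\ i = i', j = j' & k = k'].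
Proof.
move=> /mnmP E; have := (E o0, E o1, E o2).
by rewrite !mnmE /= => -[[-> ->] ->].
Qed.

(** The same set as in [num_monomials], so that its cardinal is convertible with
    [num_monomials n]. *)
Definition exponents n := [set m : 'I_n.+1 * 'I_n.+1 * 'I_n.+1 |
  (m.1.1 + 2 * m.1.2 + 3 * m.2 == n)%N].

Definition exp_monomial n (i : 'I_#|exponents n|) : {mpoly K[3]} :=
  let m := enum_val i in monomial K m.1.1 m.1.2 m.2.

Lemma exp_monomial_density n (i : 'I_#|exponents n|) :
  is_density n (exp_monomial i).
Proof.
have := enum_valP i; rewrite inE => /eqP nE.
have := is_density_monomial K (enum_val i).1.1 (enum_val i).1.2 (enum_val i).2.
by rewrite nE.
Qed.

Lemma exp_monomial_free n (c : 'I_#|exponents n| -> K) :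
  \sum_i c i *: exp_monomial i = 0 -> forall i, c i = 0.
Proof.
move=> c0 i; pose m := enum_val i.
have /(congr1 (mcoeff (mnm3 m.1.1 m.1.2 m.2))) := c0.
rewrite mcoeff0 raddf_sum (bigD1 i) //= mcoeffZ /exp_monomial monomialE mcoeffX.
rewrite eqxx mulr1 big1 ?addr0 // => j ji.
rewrite mcoeffZ monomialE mcoeffX; case: eqP; last by rewrite mulr0.
case/mnm3_inj => e1 e2 e3; case/eqP: ji; apply: enum_val_inj.
rewrite -/m; move: e1 e2 e3; case: (enum_val j) (m) => [[? ?] ?] [[? ?] ?] /=.
by move=> /val_inj -> /val_inj -> /val_inj ->.
Qed.

Lemma exp_monomial_span n (L : {mpoly K[3]}) : is_density n L ->
  exists c : 'I_#|exponents n| -> K, L = \sum_i c i *: exp_monomial i.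
Proof.
move: L; apply: density_ind.
- by exists (fun=> 0); rewrite big1 // => i _; rewrite scale0r.
- move=> a L M [c ->] [d ->]; exists (fun i => a * c i + d i).
  under [RHS]eq_bigr do rewrite scalerDl -scalerA.
  by rewrite big_split /= scaler_sumr.
move=> i j k ijk; pose m : 'I_n.+1 * 'I_n.+1 * 'I_n.+1 := (inord i, inord j, inord k).
have [iE [jE kE]] : m.1.1 = i :> nat /\ m.1.2 = j :> nat /\ m.2 = k :> nat.
  by rewrite /m /= !inordK //; lia.
have mE : m \in exponents n by rewrite inE iE jE kE ijk.
pose r := enum_rank_in mE m.
exists (fun s => (s == r)%:R); rewrite (bigD1 r) //= eqxx scale1r big1.
  by rewrite addr0 /exp_monomial /r enum_rankK_in // iE jE kE.
by move=> s /negbTE ->; rewrite scale0r.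
Qed.

Lemma trivial_c_theorem_Y6M (M : {mpoly K[3]}) : trivial_c_theorem (Y6 K * M).
Proof. by move=> a sa p; rewrite density_on_c_metric // on_ansatz_Y6M. Qed.

Lemma is_density_Y6M n (M : {mpoly K[3]}) : (6 <= n)%N ->
  is_density (n - 6) M -> is_density n (Y6 K * M).
Proof.
by move=> n6 hM; have := is_densityM (is_density_Y6 K) hM; rewrite subnKC.
Qed.

Lemma trivial_Y6_multiple n (L : {mpoly K[3]}) :
  is_density n L -> trivial_c_theorem L -> Y6_multiple n L.
Proof. by move=> hL tL; apply: trivial_density => // d; exact: trivial_c_theorem_eq0. Qed.

Lemma Y6_neq0 : Y6 K != 0.
Proof.
apply/eqP => Y0; have /eqP : eval_density (Y6 K) 0 0 1 = 0.
  by rewrite Y0 eval_densityE.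
rewrite /Y6 !eval_densityE expr1n mulr1 expr0n subr0.
by rewrite pnatr_eq0.
Qed.

(** Multiplication by the nonzero [Y6] is injective, so it carries the monomial basis in order n - 6
    to a basis of the trivial densities of order n. *)
Lemma dim_trivial_densities n : (6 <= n)%N ->
  has_dimension (fun L : {mpoly K[3]} => is_density n L /\ trivial_c_theorem L)
    (num_monomials (n - 6)).
Proof.
move=> n6; exists (fun i : 'I_#|exponents (n - 6)| => Y6 K * exp_monomial i).
split.
- move=> i; split; last exact: trivial_c_theorem_Y6M.
  exact/is_density_Y6M/exp_monomial_density.
- move=> c; under eq_bigr do rewrite scalerAr; rewrite -mulr_sumr => /eqP.
  by rewrite mulf_eq0 (negbTE Y6_neq0) => /eqP/exp_monomial_free.
move=> L [hL /(trivial_Y6_multiple hL)[M [hM _ ->]]].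
have [c ->] := exp_monomial_span hM; exists c.
by rewrite mulr_sumr; apply: eq_bigr => i _; rewrite -scalerAr.
Qed.

Lemma simple_c_theorem_C n alpha (M : {mpoly K[3]}) : (0 < n)%N ->
  simple_c_theorem (alpha *: C_density K n + Y6 K * M).
Proof.
move=> n0; pose x (a b : K) := (b / a) ^+ 2.
(* F and G are read off [on_ansatz_C] after substituting d = x - a''/a. *)
exists (fun a b => alpha * (x a b ^+ n.-1 * (3 / (2 * n%:R) * x a b - x a b))).
exists (fun a b => alpha * (x a b ^+ n.-1 / a)) => a sa p r.
rewrite density_on_c_metric // -/r on_ansatzD on_ansatzZ on_ansatz_Y6M.
by rewrite on_ansatz_C // -/(x _ _); ring.
Qed.

Lemma simple_Y6_multiple n (L : {mpoly K[3]}) : (0 < n)%N ->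
  is_density n L -> simple_c_theorem L ->
  exists alpha, Y6_multiple n (L - alpha *: C_density K n).
Proof.
move=> n0 hL /simple_c_theorem_affine[u [v]]; exact: affine_density.
Qed.
End Dimension.

Theorem mainTheorem12 (K : realType) :
  exists C : nat -> {mpoly K[3]},
    (forall n : nat, (1 <= n)%N -> is_C_density n (C n)) /\
    (forall (n : nat) (L : {mpoly K[3]}), (6 <= n)%N ->
       (is_density n L /\ simple_c_theorem L <->
        exists (alpha : K) (M : {mpoly K[3]}),
          is_density (n - 6) M /\ L = alpha *: C n + Y6 K * M)) /\
    (forall (n : nat) (L : {mpoly K[3]}), (1 <= n <= 5)%N ->
       (is_density n L /\ simple_c_theorem L <->
        exists alpha : K, L = alpha *: C n)) /\
    (forall (n : nat) (L : {mpoly K[3]}),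
       is_density n L -> trivial_c_theorem L ->
       exists (m : nat) (M : {mpoly K[3]}), is_density m M /\ L = Y6 K * M) /\
    (forall n : nat, (6 <= n)%N ->
       has_dimension
         (fun L : {mpoly K[3]} => is_density n L /\ trivial_c_theorem L)
         (num_monomials (n - 6)) /\
       (num_monomials (n - 6))%:Z = (num_monomials n)%:Z - n%:Z).
Proof.
exists (C_density K); split; first by move=> n; exact: is_C_density_C.
split=> [n L n6|].
  have n0 : (0 < n)%N by lia.
  split=> [[hL /(simple_Y6_multiple n0 hL)[alpha [M [hM _ LE]]]]|].
    by exists alpha, M; rewrite -LE addrCA subrr addr0.
  move=> [alpha [M [hM ->]]]; split; last exact: simple_c_theorem_C.
  by apply/is_densityD/is_density_Y6M => //; exact/is_densityZ/is_density_C.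
split=> [n L /andP[n0 n5]|].
  split=> [[hL /(simple_Y6_multiple n0 hL)[alpha [M [_ M0 LE]]]]|].
    (* As n < 6, the cofactor of [Y6] is zero. *)
    by exists alpha; apply/eqP; rewrite -subr_eq0 LE M0 ?mulr0.
  move=> [alpha ->]; split; first exact/is_densityZ/is_density_C.
  by have := simple_c_theorem_C alpha 0 n0; rewrite mulr0 addr0.
split=> [n L hL /(trivial_Y6_multiple hL)[M [hM _ LE]]|n n6].
  by exists (n - 6)%N, M.
split; first exact: dim_trivial_densities.
by have := num_monomials_add6 (n - 6); rewrite subnK //; lia.
Qed.
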